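(* Let $y\in\operatorname{ran}(\mathbf A)$, let $(y_k)_k\in\mathbb Y^{\mathbb N}$ with $\|y_k-y\|\le\delta_k$, $\delta_k\to0$, and let $\alpha_k\asymp\delta_k$. For each $k$ let $x_k\in\mathbb X$ be an $(\alpha_k\phi)$-critical point of $\mathcal H_k=\frac12\|\mathbf A(\cdot)-y_k\|^2+\alpha_k\mathcal R$, let $x^\ddagger\in\mathbb X$ be the weak limit of $(x_k)_k$, and write $\Delta_k=\mathcal H_k(x_k)-\mathcal H_k(x^\ddagger)$. Assume: (C1) there exists $\xi\in\partial_\phi\mathcal R(x^\ddagger)\cap\operatorname{ran}(\mathbf A^* )$; (C2) there is a constant $c$ such that $\mathcal R(x^\ddagger)-\mathcal R(z)\le c\,\|\mathbf A z-\mathbf A x^\ddagger\|$ for all $z\in\mathcal B(x^\ddagger)=\{x\in\mathbb X : |\mathcal R(x^\ddagger)-\mathcal R(x)|\le\varepsilon\}$, where $\varepsilon>\max\{0,\sup_k\Delta_k/\alpha_k\}$. Then, with $\xi$ as in (C1): (1) $\|\mathbf A x_k-y_k\|=\mathcal O\bigl(\sqrt{\delta_k^2+\Delta_k}\bigr)$; (2) $|D_\xi(x_k,x^\ddagger)|=\mathcal O(\delta_k+\Delta_k/\delta_k)$.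
   Context: $\mathbb X,\mathbb Y$ are Hilbert spaces and $\mathbf A\colon\mathbb X\to\mathbb Y$ is linear and bounded with adjoint $\mathbf A^*$ and range $\operatorname{ran}(\mathbf A)$. $\phi\colon\mathbb X\to[0,\infty)$ is a function. For a functional $\mathcal F\colon\mathbb X\to\mathbb R$ and $\psi\colon\mathbb X\to[0,\infty)$, an element $\xi\in\mathbb X$ is a $\psi$-relative subgradient of $\mathcal F$ at $x_0\in\mathbb X$ if $\mathcal F(x_0)+\langle\xi,x-x_0\rangle\le\mathcal F(x)+\psi(x)$ for all $x\in\mathbb X$; the set of these is $\partial_\psi\mathcal F(x_0)$. $\mathcal F$ is $\psi$-relatively subdifferentiable if $\partial_\psi\mathcal F(x)\ne\emptyset$ for all $x\in\mathbb X$. A point $x_0$ is a $\psi$-critical point of $\mathcal F$ if $0\in\partial_\psi\mathcal F(x_0)$, i.e. $\mathcal F(x_0)\le\mathcal F(x)+\psi(x)$ for all $x\in\mathbb X$. Standing assumptions: $\mathcal R\colon\mathbb X\to[0,\infty)$ is weakly lower semicontinuous, $\phi$-relatively subdifferentiable, and for every $\alpha>0$ and every $y^\delta\in\mathbb Y$ the functional $\frac12\|\mathbf A(\cdot)-y^\delta\|^2+\alpha\mathcal R$ is coercive. The Bregman-distance with $\xi$ is $D_\xi(x,x^\ddagger)=\mathcal R(x)-\mathcal R(x^\ddagger)-\langle\xi,x-x^\ddagger\rangle$. The quantity $\Delta_k$ is called the Tikhonov gap between $x_k$ and $x^\ddagger$. The numbers $\delta_k,\alpha_k$ are positive, and $\alpha_k\asymp\delta_k$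 means that there are constants $C_1,C_2>0$ with $C_1\delta_k\le\alpha_k\le C_2\delta_k$ as $\delta_k\to0$.
   Formalization: In the bounds (1) and (2), Δ_k is replaced by its positive part max(0, Δ_k), since with Δ_k < 0 the printed right-hand sides can be zero or negative and the claims fail (e.g. A = id on ℝ, R = |x|, y_k = y = 1, α_k = √2 δ_k). *)

(* Defs.v *)
From HB Require Import structures.
From mathcomp Require Import all_boot all_order all_algebra sesquilinear.
From mathcomp Require Import all_classical all_reals all_analysis.

Set Implicit Arguments.
Unset Strict Implicit.
Unset Printing Implicit Defensive.

Import Order.TTheory GRing.Theory Num.Theory.
Import numFieldNormedType.Exports.

Local Open Scope classical_set_scope.
Local Open Scope ring_scope.

(* Real Hilbert spaces: complete normed spaces whose norm comes from an inner
   product.  Over a real field, [{dot X for idfun}] is the type of symmetric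
   positive definite bilinear forms on X. *)
HB.mixin Record CompleteNormedModule_isHilbert (R : realType) X
    of CompleteNormedModule R X := {
  inner : {dot X for (@idfun R)};
  inner_sqr_norm : forall x : X, inner x x = `|x| ^+ 2 }.

#[short(type="hilbertType")]
HB.structure Definition Hilbert (R : realType) :=
  {X of CompleteNormedModule R X & CompleteNormedModule_isHilbert R X}.

Section Hilbert_space_notions.
Context {R : realType}.

Definition is_adjoint {X Y : hilbertType R} (A : X -> Y) (Astar : Y -> X) :=
  forall x w, inner (A x) w = inner x (Astar w).

Definition weak_cvg {X : hilbertType R} (u : nat -> X) (x : X) :=
  forall z, inner (u n) z @[n --> \oo] --> inner x z.

(* Semicontinuity along weakly convergent sequences, the usual meaning in
   variational regularization; lower semicontinuity for the weak topology
   implies it. *)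
Definition weakly_lsc {X : hilbertType R} (F : X -> R) :=
  forall (u : nat -> X) (x : X), weak_cvg u x ->
    ((F x)%:E <= limn_einf (fun n => (F (u n))%:E))%E.

Definition coercive {X : hilbertType R} (F : X -> R) :=
  forall M : R, exists r : R, forall x, r <= `|x| -> M <= F x.

Definition rel_subdiff {X : hilbertType R} (psi F : X -> R) (x0 : X) : set X :=
  [set xi | forall x, F x0 + inner xi (x - x0) <= F x + psi x].

Definition rel_subdifferentiable {X : hilbertType R} (psi F : X -> R) :=
  forall x, rel_subdiff psi F x !=set0.

Definition rel_critical {X : hilbertType R} (psi F : X -> R) (x0 : X) :=
  rel_subdiff psi F x0 0.

Definition tikhonov {X Y : hilbertType R} (A : X -> Y) (Reg : X -> R)
    (alpha : R) (y : Y) (x : X) : R :=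
  2^-1 * `|A x - y| ^+ 2 + alpha * Reg x.

Definition tikhonov_gap {X Y : hilbertType R} (A : X -> Y) (Reg : X -> R)
    (alpha : R) (y : Y) (x xd : X) : R :=
  tikhonov A Reg alpha y x - tikhonov A Reg alpha y xd.

Definition bregman {X : hilbertType R} (Reg : X -> R) (xi x xd : X) : R :=
  Reg x - Reg xd - inner xi (x - xd).

Definition same_order (a d : nat -> R) :=
  exists C1 C2, [/\ 0 < C1, 0 < C2 &
    \forall k \near \oo, C1 * d k <= a k <= C2 * d k].

End Hilbert_space_notions.

(* Main.v *)
(* Testing criticality of x_k at a preimage of y gives A x_k -> y, and A, having
   an adjoint, is weakly continuous, so A xd = y.  The definition of the gap
   bounds R(x_k) - R(xd) from above by (gap_k + delta_k^2 / 2) / alpha_k, whose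
   limsup is below eps because the sup of gap_k / alpha_k is; weak lower
   semicontinuity bounds it from below by -eps.  Hence (C2) eventually applies
   to x_k and gives, with r_k = |A x_k - y_k|,
     r_k^2 <= 2 gap_k + delta_k^2 + O(delta_k) (r_k + delta_k),
   which is solved for r_k by Young's inequality.  In the Bregman distance, the
   source condition xi = A* w turns the linear term into <w, A x_k - y>, which
   is O(r_k + delta_k). *)
Require Import Defs.
From mathcomp Require Import all_boot all_order all_algebra sesquilinear.
From mathcomp Require Import all_classical all_reals all_analysis ring lra.

Import Order.TTheory GRing.Theory Num.Theory.
Import numFieldNormedType.Exports.

Local Open Scope classical_set_scope.
Local Open Scope ring_scope.

(** Cauchy-Schwarz from the triangle inequality: squaring [|w + z| <= |w| + |z|] and cancelling
    leaves the one-sided bound, and [- u] supplies the other side. *)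
Lemma ler_norm_inner {R : realType} {X : hilbertType R} (u v : X) :
  `|inner u v| <= `|u| * `|v|.
Proof.
have polar (w z : X) : inner w z <= `|w| * `|z|.
  have : `|w + z| ^+ 2 <= (`|w| + `|z|) ^+ 2 by rewrite lerXn2r ?nnegrE ?ler_normD.
  have -> : `|w + z| ^+ 2 = `|w| ^+ 2 + inner w z *+ 2 + `|z| ^+ 2.
    rewrite -!inner_sqr_norm linearDl !linearDr/=.
    rewrite (hermC _ z w)/= expr0 mul1r; ring.
  rewrite sqrrD; lra.
rewrite ler_norml polar andbT lerNl.
by have := polar (- u) v; rewrite linearNl normrN.
Qed.

(** Tested against [z = x' - x], the sequence [inner (u n) z] tends both to [inner x' z] and, by
    Cauchy-Schwarz, to [inner x z]; hence [|z|^2 = 0]. *)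
Lemma weak_cvg_norm_unique {R : realType} {X : hilbertType R} (u : nat -> X) (x x' : X) :
  `|u n - x| @[n --> \oo] --> (0 : R) -> weak_cvg u x' -> x' = x.
Proof.
move=> ux uwx'; apply/eqP; rewrite -subr_eq0 -normr_eq0 -sqrf_eq0.
rewrite -inner_sqr_norm linearBl subr_eq0; apply/eqP.
set z := x' - x; apply: (cvg_unique _ (uwx' z)) => //.
have uxz : inner (u n - x) z @[n --> \oo] --> (0 : R).
  apply/cvgr0Pnorm_le => e e0.
  have uxz0 : `|u n - x| * `|z| @[n --> \oo] --> (0 : R).
    by rewrite -(mul0r `|z|); apply: cvgMl.
  have /cvgr0Pnorm_le/(_ e e0) := uxz0.
  apply: filterS => n; rewrite ger0_norm ?mulr_ge0 //.
  exact: le_trans (ler_norm_inner _ _).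
have : inner (u n - x) z + inner x z @[n --> \oo] --> 0 + inner x z.
  by apply: cvgD => //; exact: cvg_cst.
rewrite add0r; apply: cvg_trans; apply: near_eq_cvg; near=> n.
by rewrite linearBl subrK.
Unshelve. all: by end_near. Qed.

Lemma weakly_lsc_near {R : realType} {X : hilbertType R} (F : X -> R)
    (u : nat -> X) (x : X) (e : R) :
  weakly_lsc F -> weak_cvg u x -> 0 < e ->
  \forall n \near \oo, F x - F (u n) <= e.
Proof.
move=> Flsc ux e0; have := Flsc u x ux; rewrite limn_einf_lim => lsc.
set v := fun n => (F (u n))%:E in lsc.
have Fxe : ((F x - e)%:E < limn (einfs v))%E.
  by apply: lt_le_trans lsc; rewrite lte_fin ltrBlDr ltrDl.
have cv : cvgn (einfs v) by exact: is_cvg_einfs.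
have : \forall n \near \oo, ((F x - e)%:E < einfs v n)%E.
  exact: cv _ (open_ereal_gt' Fxe).
apply: filterS => n /= einf_gt.
have : ((F x - e)%:E < v n)%E.
  by apply: lt_le_trans einf_gt _; apply: ereal_inf_lbound; exists n => /=.
by rewrite lte_fin; lra.
Qed.

(** Young's inequality [2 K d r <= r^2 / 2 + 2 K^2 d^2] absorbs [r] and leaves
    [r^2 <= 4 g + (2 + 4 K + 4 K^2) d^2], which is below [(2 + 2 K)^2 (d^2 + g)]. *)
Lemma residual_rate {R : realType} (r d g K : R) :
  0 <= r -> 0 <= d -> 0 <= g -> 0 <= K ->
  r ^+ 2 <= 2 * g + d ^+ 2 + 2 * K * d * (r + d) ->
  r <= (2 + 2 * K) * Num.sqrt (d ^+ 2 + g).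
Proof.
move=> r0 d0 g0 K0 rd.
have s0 : 0 <= d ^+ 2 + g by rewrite addr_ge0 ?sqr_ge0.
rewrite -(@ler_pXn2r _ 2) ?nnegrE ?mulr_ge0 ?sqrtr_ge0 ?addr_ge0 ?mulr_ge0 //.
rewrite exprMn sqr_sqrtr //.
have := sqr_ge0 (r - 2 * K * d) => ?.
have ? : 0 <= K * g by rewrite mulr_ge0.
have ? : 0 <= K ^+ 2 * g by rewrite mulr_ge0 ?sqr_ge0.
have ? : 0 <= K * d ^+ 2 by rewrite mulr_ge0 ?sqr_ge0.
have ? := sqr_ge0 d.
nra.
Qed.

(** Passes from the scale of the residual rate to that of the Bregman rate; the cross term of
    [(d + g / d)^2] is already [2 g]. *)
Lemma sqrt_sqrD_le {R : realType} (d g : R) :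
  0 < d -> 0 <= g -> Num.sqrt (d ^+ 2 + g) <= d + g / d.
Proof.
move=> d0 g0; have gd0 : 0 <= g / d by rewrite divr_ge0 // ltW.
rewrite -(@ler_pXn2r _ 2) ?nnegrE ?sqrtr_ge0 ?addr_ge0 ?(ltW d0) //.
rewrite sqr_sqrtr ?addr_ge0 ?sqr_ge0 //.
have {1}-> : g = d * (g / d) by field; exact: lt0r_neq0.
have : 0 <= d * (g / d) by rewrite mulr_ge0 // ltW.
have := sqr_ge0 (g / d); nra.
Qed.

Theorem theorem4p1 (R : realType) (X Y : hilbertType R)
  (A : {linear X -> Y}) (Astar : Y -> X) (phi Reg : X -> R)
  (A_bounded : bounded_near A (nbhs (0 : X)))
  (A_adjoint : is_adjoint A Astar)
  (phi_ge0 : forall x, 0 <= phi x)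
  (Reg_ge0 : forall x, 0 <= Reg x)
  (Reg_wlsc : weakly_lsc Reg)
  (Reg_subdiff : rel_subdifferentiable phi Reg)
  (Reg_coercive : forall (a : R) (yd : Y), 0 < a ->
     coercive (tikhonov A Reg a yd))
  (y : Y) (y_ran : range A y)
  (ys : nat -> Y) (delta alpha : nat -> R)
  (delta_gt0 : forall k, 0 < delta k)
  (alpha_gt0 : forall k, 0 < alpha k)
  (ys_noise : forall k, `|ys k - y| <= delta k)
  (delta_cvg0 : delta k @[k --> \oo] --> (0 : R))
  (alpha_delta : same_order alpha delta)
  (xs : nat -> X) (xd : X)
  (xs_critical : forall k,
     rel_critical (fun x => alpha k * phi x)
       (tikhonov A Reg (alpha k) (ys k)) (xs k))
  (xs_weak : weak_cvg xs xd)
  (xi : X)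
  (C1 : (rel_subdiff phi Reg xd `&` range Astar) xi)
  (c eps : R)
  (eps_gt : (maxe 0 (ereal_sup (range (fun k =>
     (tikhonov_gap A Reg (alpha k) (ys k) (xs k) xd / alpha k)%:E)))
     < eps%:E)%E)
  (C2 : forall z, `|Reg xd - Reg z| <= eps ->
     Reg xd - Reg z <= c * `|A z - A xd|) :
  let gap k := tikhonov_gap A Reg (alpha k) (ys k) (xs k) xd in
  ((fun k => `|A (xs k) - ys k| : R^o) =O_\oo
     (fun k => Num.sqrt (delta k ^+ 2 + Num.max 0 (gap k)) : R^o)) /\
  ((fun k => `|bregman Reg xi (xs k) xd| : R^o) =O_\oo
     (fun k => delta k + Num.max 0 (gap k) / delta k : R^o)).
Proof.
have [C_lo [C_hi [Clo0 Chi0 alpha_near]]] := alpha_delta.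
have [x0 _ Ax0] := y_ran.
have [xi_sub [w _ xiw]] := C1.
pose r k := `|A (xs k) - ys k|.
have r_ge0 k : 0 <= r k by exact: normr_ge0.
have Axs_y k : `|A (xs k) - y| <= r k + delta k.
  have -> : A (xs k) - y = (A (xs k) - ys k) + (ys k - y) by rewrite addrA subrK.
  by rewrite (le_trans (ler_normD _ _)) // lerD2l.
have r_cvg0 : r k @[k --> \oo] --> (0 : R).
  (* Twice the penalty terms at the preimage [x0], with [alpha k] replaced by [C_hi * delta k]. *)
  pose D := 2 * C_hi * (Reg x0 + phi x0).
  have r2 : \forall k \near \oo, r k ^+ 2 <= delta k * delta k + D * delta k.
    apply: filterS alpha_near => k /andP[_ ak].
    have := xs_critical k x0; rewrite linear0l addr0 /tikhonov -/(r k) Ax0 => H.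
    have : `|y - ys k| ^+ 2 <= delta k ^+ 2.
      by rewrite lerXn2r ?nnegrE ?(ltW (delta_gt0 k)) // distrC.
    have := ler_wpM2r (addr_ge0 (Reg_ge0 x0) (phi_ge0 x0)) ak.
    have : 0 <= alpha k * Reg (xs k) by rewrite mulr_ge0 // ltW.
    rewrite /D; nra.
  have lim0 : delta k * delta k + D * delta k @[k --> \oo] --> (0 : R).
    have : delta k * delta k + D * delta k @[k --> \oo] --> (0 * 0 + D * 0 : R).
      by apply: cvgD; [exact: cvgM | apply: cvgM => //; exact: cvg_cst].
    by rewrite !mulr0 addr0.
  apply/cvgr0Pnorm_le => e e0.
  have /cvgr0Pnorm_le/(_ (e ^+ 2) (exprn_gt0 _ e0)) := lim0.
  apply: filterS2 r2 => k rk dk.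
  rewrite ger0_norm // -(@ler_pXn2r _ 2) ?nnegrE ?(ltW e0) //.
  exact: le_trans rk (le_trans (ler_norm _) dk).
have Axd : A xd = y.
  apply: (@weak_cvg_norm_unique _ _ (fun k => A (xs k))); last first.
    by move=> z; rewrite A_adjoint; under eq_fun do rewrite A_adjoint;
       exact: xs_weak.
  have rd0 : r k + delta k @[k --> \oo] --> (0 : R).
    by rewrite -(addr0 0); exact: cvgD.
  apply: (squeeze_cvgr _ (cvg_cst 0) rd0).
  by apply: nearW => k; rewrite normr_ge0 Axs_y.
have noise2 k : `|A xd - ys k| ^+ 2 <= delta k ^+ 2.
  by rewrite lerXn2r ?nnegrE ?(ltW (delta_gt0 k)) // Axd distrC.
(* A bound [m] uniform in [k] leaves the fixed margin [eps - m] for the noise. The supremum itself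
   serves, being finite between 0 and [eps]. *)
have [m meps mgap] : exists2 m, m < eps & forall k,
    tikhonov_gap A Reg (alpha k) (ys k) (xs k) xd / alpha k <= m.
  move: eps_gt; set s := (X in (X < _)%E) => seps.
  have s0 : (0 <= s)%E by rewrite le_max lexx.
  have sfin : s \is a fin_num by rewrite ge0_fin_numE // (lt_trans seps) ?ltry.
  exists (fine s); first by rewrite -lte_fin fineK.
  move=> k; rewrite -lee_fin fineK // le_max; apply/orP; right.
  by apply: ereal_sup_ubound; exists k.
have eps0 : 0 < eps.
  by move: eps_gt; rewrite gt_max lte_fin => /andP[].
move=> gap.
have gap_def k : gap k = 2^-1 * r k ^+ 2 + alpha k * Reg (xs k)
    - (2^-1 * `|A xd - ys k| ^+ 2 + alpha k * Reg xd) by [].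
(* The gap may be negative; its positive part keeps radicand and quotient nonnegative. *)
pose g k := Num.max 0 (gap k).
have g0 k : 0 <= g k by rewrite le_max lexx.
have gapg k : gap k <= g k by rewrite le_max lexx orbT.
have Reg_excess k : alpha k * (Reg (xs k) - Reg xd) <= gap k + 2^-1 * delta k ^+ 2.
  have := noise2 k; have := sqr_ge0 (r k); rewrite gap_def; lra.
have Reg_level : \forall k \near \oo, `|Reg xd - Reg (xs k)| <= eps.
  (* Then [delta^2 / (2 alpha) <= delta / (2 C_lo) <= (eps - m) / 2], so the noise term fits into
     the margin. *)
  have dsmall : \forall k \near \oo, delta k <= C_lo * (eps - m).
    have dp : 0 < C_lo * (eps - m) by rewrite mulr_gt0 // subr_gt0.
    have /cvgr0Pnorm_le/(_ _ dp) := delta_cvg0.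
    by apply: filterS => k; apply: le_trans; exact: ler_norm.
  have lsc := weakly_lsc_near _ _ _ _ Reg_wlsc xs_weak eps0.
  apply: filterS3 alpha_near dsmall lsc => k /andP[ak _] dk lk.
  rewrite ler_norml lk andbT lerNl opprB -(ler_pM2l (alpha_gt0 k)).
  apply: le_trans (Reg_excess k) _.
  have := mgap k; rewrite ler_pdivrMr // -/(gap k) => mk.
  have := delta_gt0 k.
  have := ler_wpM2r (ltW (delta_gt0 k)) dk.
  have : m < eps by [].
  have : C_lo * delta k * (eps - m) <= alpha k * (eps - m).
    by rewrite ler_wpM2r // subr_ge0 ltW.
  nra.
(* The sign of [c] is unknown, and enlarging [|A x_k - y|] to [r k + delta k] requires a nonnegative
   factor. *)
pose K := Num.max 0 c.
have K0 : 0 <= K by rewrite le_max lexx.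
have source : \forall k \near \oo, Reg xd - Reg (xs k) <= K * (r k + delta k).
  apply: filterS Reg_level => k /C2 /le_trans; apply.
  rewrite Axd (@le_trans _ _ (K * `|A (xs k) - y|)) //.
    by rewrite ler_wpM2r // le_max lexx orbT.
  by rewrite ler_wpM2l.
have KC0 : 0 <= C_hi * K by rewrite mulr_ge0 // ltW.
pose M := 2 + 2 * (C_hi * K).
(* [source] times [alpha k <= C_hi * delta k] gives the hypothesis of [residual_rate] with
   [C_hi * K] as its constant. *)
have rate : \forall k \near \oo, r k <= M * Num.sqrt (delta k ^+ 2 + g k).
  apply: filterS2 alpha_near source => k /andP[_ ak] sk.
  have d0 := delta_gt0 k; apply: residual_rate => //; first exact: ltW.
  have rd0 : 0 <= K * (r k + delta k) by rewrite mulr_ge0 // addr_ge0 // ltW.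
  have := ler_wpM2l (ltW (alpha_gt0 k)) sk.
  have := ler_wpM2r rd0 ak.
  have := gapg k; have := noise2 k; rewrite gap_def; nra.
split; apply/eqO_exP.
  exists M; first by rewrite /M; lra.
  by apply: filterS rate => k; rewrite normr_id ger0_norm // sqrtr_ge0.
pose L := K + `|w|.
have L0 : 0 <= L by rewrite addr_ge0.
have Mpos : 0 < M by rewrite /M; lra.
(* [C_lo^-1] bounds [Reg (xs k) - Reg xd] from above; [L] combines its lower bound, through [K],
   with the linear term, through [|w|]. *)
exists (C_lo^-1 + L * (M + 1)).
  by rewrite ltr_pwDl ?invr_gt0 // mulr_ge0 // addr_ge0 // ltW.
apply: filterS3 alpha_near source rate => k /andP[ak _] sk rk.
have d0 := delta_gt0 k.
have gd0 : 0 <= g k / delta k by rewrite divr_ge0 // ltW.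
rewrite normr_id [X in _ <= _ * X]ger0_norm ?addr_ge0 ?(ltW d0) //.
set E := delta k + g k / delta k.
have rdE : r k + delta k <= (M + 1) * E.
  have := sqrt_sqrD_le _ _ d0 (g0 k); rewrite -/E => sE.
  have := ler_wpM2l (ltW Mpos) sE; have : delta k <= E by rewrite lerDl.
  lra.
have innerE : `|inner xi (xs k - xd)| <= `|w| * (r k + delta k).
  rewrite -xiw hermC expr0 mul1r /= -A_adjoint linearB Axd mulrC.
  by rewrite (le_trans (ler_norm_inner _ _)) // ler_wpM2r.
have CE : 0 <= C_lo^-1 * E.
  by rewrite mulr_ge0 ?invr_ge0 ?addr_ge0 ?(ltW d0) ?(ltW Clo0).
(* [Reg_excess] divided by [alpha k >= C_lo * delta k], since [delta k * E = delta k ^+ 2 + g k]. *)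
have excess : Reg (xs k) - Reg xd <= C_lo^-1 * E.
  have Cd : 0 < C_lo * delta k by rewrite mulr_gt0.
  have dE : C_lo * delta k * (C_lo^-1 * E) = delta k ^+ 2 + g k.
    by rewrite /E; field; rewrite !lt0r_neq0.
  rewrite -(ler_pM2l (alpha_gt0 k)) (le_trans (Reg_excess k)) //.
  have := ler_wpM2r CE ak; rewrite dE.
  have := gapg k; have := sqr_ge0 (delta k); lra.
have Lr : L * (r k + delta k) <= L * (M + 1) * E by rewrite -mulrA ler_wpM2l.
have Kr : 0 <= K * (r k + delta k) by rewrite mulr_ge0 // addr_ge0 // ltW.
move: innerE Lr; rewrite /bregman /L !ler_norml => /andP[i1 i2] Lr.
by apply/andP; split; lra.
Qed.
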